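(* If $G$ is a finite non-Abelian AC-group, then the commuting graph $\Gamma_G$ is neither hyperenergetic nor borderenergetic.
   Context: A group $G$ is an AC-group if the centralizer $C_G(g)=\{a\in G\mid ag=ga\}$ is Abelian for every $g\in G\setminus Z(G)$, where $Z(G)$ is the center. For a finite non-Abelian group $G$, the commuting graph $\Gamma_G$ is the simple undirected graph with vertex set $G\setminus Z(G)$ in which two distinct vertices $a,b$ are adjacent iff $ab=ba$. The energy $\mathcal{E}(\Gamma)$ of a finite graph $\Gamma$ is the sum of the absolute values of the eigenvalues of its adjacency matrix, counted with multiplicity. With $N$ the number of vertices of $\Gamma$ and $K_N$ the complete graph on $N$ vertices (so $\mathcal{E}(K_N)=2N-2$), $\Gamma$ is hyperenergetic if $\mathcal{E}(\Gamma)>\mathcal{E}(K_N)$ and borderenergetic if $\mathcal{E}(\Gamma)=\mathcal{E}(K_N)$. *)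

(* Defs.v *)
From mathcomp Require Import all_boot all_order all_algebra all_fingroup all_solvable all_field.

Set Implicit Arguments.
Unset Strict Implicit.
Unset Printing Implicit Defensive.

Import Order.TTheory GRing.Theory Num.Theory.
Local Open Scope ring_scope.

Definition AC_group (gT : finGroupType) (G : {group gT}) : Prop :=
  forall g, g \in G :\: 'Z(G)%g -> abelian 'C_G[g]%g.

Record sgraph := SGraph {
  vertex :> finType;
  adj : rel vertex;
  adj_sym : symmetric adj;
  adj_irrefl : irreflexive adj
}.

Definition adjacency_matrix (Gamma : sgraph) : 'M[algC]_#|Gamma| :=
  \matrix_(i, j) (adj (enum_val i) (enum_val j))%:R.

(* The roots of the characteristic polynomial, listed with multiplicity:
   char_poly A = \prod_(a <- eigenvalues A) ('X - a%:P), as char_poly A is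
   monic. *)
Definition eigenvalues (n : nat) (A : 'M[algC]_n) : seq algC :=
  sval (closed_field_poly_normal (char_poly A)).

Definition energy (Gamma : sgraph) : algC :=
  \sum_(a <- eigenvalues (adjacency_matrix Gamma)) `|a|.

Definition complete_adj (N : nat) : rel 'I_N := fun i j => i != j.

Lemma complete_adj_sym (N : nat) : symmetric (@complete_adj N).
Proof. by move=> i j; rewrite /complete_adj eq_sym. Qed.

Lemma complete_adj_irrefl (N : nat) : irreflexive (@complete_adj N).
Proof. by move=> i; rewrite /complete_adj eqxx. Qed.

Definition complete_graph (N : nat) : sgraph :=
  SGraph (@complete_adj_sym N) (@complete_adj_irrefl N).

(* Energies are sums of norms, hence real, so the partial order of algC
   restricts to the usual total order on them. *)
Definition hyperenergetic (Gamma : sgraph) : Prop :=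
  energy (complete_graph #|Gamma|) < energy Gamma.

Definition borderenergetic (Gamma : sgraph) : Prop :=
  energy Gamma = energy (complete_graph #|Gamma|).

Section CommutingGraph.

Variables (gT : finGroupType) (G : {group gT}).

Definition noncentral : finType := {x : gT | x \in G :\: 'Z(G)%g}.

Definition commuting_adj : rel noncentral :=
  fun a b => (a != b) && (val a * val b == val b * val a)%g.

Lemma commuting_adj_sym : symmetric commuting_adj.
Proof.
by move=> a b; rewrite /commuting_adj eq_sym; congr andb; rewrite eq_sym.
Qed.

Lemma commuting_adj_irrefl : irreflexive commuting_adj.
Proof. by move=> a; rewrite /commuting_adj eqxx. Qed.

Definition commuting_graph : sgraph :=
  SGraph commuting_adj_sym commuting_adj_irrefl.

End CommutingGraph.

(* Main.v *)
(* In an AC-group, commuting is an equivalence relation on the noncentral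
   elements, so the commuting graph is a disjoint union of k cliques.  If f
   labels each vertex by its clique and P is the incidence matrix of f, the
   adjacency matrix is P^T P - 1, whereas P P^T is diagonal with the clique
   sizes as nonzero entries; since det (c - P^T P) = det (c - P P^T), the
   eigenvalues are the clique sizes minus 1 and -1 with multiplicity N - k.
   Hence the energy is 2 (N - k), and k > 1 as two elements do not commute. *)
Require Import Defs.
From mathcomp Require Import all_boot all_order all_algebra all_fingroup all_solvable all_field.

Set Implicit Arguments.
Unset Strict Implicit.
Unset Printing Implicit Defensive.

Import Order.TTheory GRing.Theory Num.Theory.
Local Open Scope ring_scope.

(** Both sides are read off the block matrix [M]: clearing [B] by a column operation gives the left
    determinant, clearing it from the left gives [c ^+ n] times the right one, and [c ^+ n]
    cancels. *)
Lemma det_scalar_sub_mulmxC (R : idomainType) (n : nat) (c : R)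
    (A B : 'M[R]_n) :
  c != 0 -> \det (c%:M - A *m B) = \det (c%:M - B *m A).
Proof.
move=> c0; pose M := block_mx c%:M A B 1%:M.
have detl : \det M = \det (c%:M - A *m B).
  have : \det (M *m block_mx 1%:M 0 (- B) 1%:M) = \det (c%:M - A *m B).
    rewrite mulmx_block !(mulmx0, mulmx1, mul1mx, add0r) mulmxN subrr.
    by rewrite det_ublock det1 mulr1.
  by rewrite det_mulmx det_lblock !det1 !mulr1.
have : \det (block_mx 1%:M 0 (- B) c%:M *m M) = c ^+ n * \det (c%:M - B *m A).
  rewrite mulmx_block !(mul0mx, mulmx1, mul1mx, addr0) mulNmx mul_mx_scalar.
  rewrite mul_scalar_mx addNr det_ublock det_scalar mulNmx.
  by rewrite [- _ + _]addrC.
rewrite det_mulmx det_lblock det1 mul1r det_scalar detl.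
by apply: mulfI; rewrite expf_neq0.
Qed.

Section FiberGraph.

Variables (Gamma : sgraph) (f : Gamma -> Gamma).
Hypothesis adjE : forall x y, adj x y = (x != y) && (f x == f y).

Let A := adjacency_matrix Gamma.
Let fiber (x : Gamma) : nat := #|[pred y | f y == x]|.

Let rank_bij P := onW_bij P (@enum_rank_bij Gamma).

(** Labels are vertices, so the incidence matrix is square. A vertex outside the image of [f] has an
    empty fiber and contributes the root -1. *)
Lemma char_poly_fiber_graph :
  char_poly A = \prod_(x : Gamma) ('X - ((fiber x)%:R - 1)%:P).
Proof.
pose P : 'M[{poly algC}]_#|Gamma| :=
  \matrix_(i, j) (f (enum_val j) == enum_val i)%:R.
have -> : char_poly A = \det (('X + 1)%:M - P^T *m P).
  congr (\det _); apply/matrixP=> i j; rewrite !mxE adjE (inj_eq enum_val_inj).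
  rewrite (reindex _ (rank_bij _)) /=.
  under eq_bigr do rewrite !mxE enum_rankK.
  (* Only the label of vertex [i] contributes to entry [(i, j)] of [P^T *m P]. *)
  rewrite (bigD1 (f (enum_val i))) //= eqxx mul1r
    big1 => [|k /negPf ki]; last first.
    by rewrite eq_sym ki mul0r.
  rewrite addr0 [f (enum_val j) == _]eq_sym.
  case: (eqVneq i j) => [->|ij] /=.
    by rewrite eqxx !mulr1n polyC0 subr0 addrK.
  by rewrite !mulr0n; case: eqP.
rewrite det_scalar_sub_mulmxC; last by rewrite -[1]opprK -polyCN polyXsubC_eq0.
have -> : P *m P^T = diag_mx (\row_i (fiber (enum_val i))%:R).
  apply/matrixP=> i j; rewrite !mxE (reindex _ (rank_bij _)) /=.
  under eq_bigr do rewrite !mxE enum_rankK.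
  case: (eqVneq i j) => [<-|ij] /=.
    rewrite mulr1n /fiber -sum1_card natr_sum [RHS]big_mkcond /=.
    by apply: eq_bigr => k _; rewrite inE; case: eqP; rewrite ?mulr1 ?mulr0.
  rewrite big1 // => k _; case: eqP => [->|]; rewrite ?mul0r //.
  by rewrite (inj_eq enum_val_inj) (negPf ij) mulr0.
rewrite -diag_const_mx -linearB /= det_diag (reindex _ (rank_bij _)) /=.
apply: eq_bigr => x _; rewrite !mxE enum_rankK.
by rewrite polyCB opprB addrA polyC_natr.
Qed.

Lemma energy_fiber_graph :
  energy Gamma = \sum_(x : Gamma) `|(fiber x)%:R - 1|.
Proof.
have := char_poly_fiber_graph; rewrite /energy /eigenvalues.
case: closed_field_poly_normal => /= r ->.
rewrite (monicP (char_poly_monic _)) scale1r.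
rewrite -(big_map (fun x => (fiber x)%:R - 1) xpredT (fun a => 'X - a%:P)).
(* Equal products of monic linear factors have the same roots up to permutation. *)
by move/prod_XsubC_eq => eq_r; rewrite (perm_big _ eq_r) big_map.
Qed.

Lemma energy_fiber_graph_codom :
  energy Gamma = (2 * #|Gamma|)%:R - (2 * #|codom f|)%:R.
Proof.
have sum_fiber : \sum_x (fiber x)%:R = #|Gamma|%:R :> algC.
  rewrite -natr_sum -[#|Gamma|]sum1_card; congr _%:R.
  rewrite [RHS](partition_big f xpredT) //; apply: eq_bigr => x _.
  by rewrite sum1dep_card; apply: eq_card => y; rewrite !inE.
(* The norm changes the value only at an empty fiber, where -1 becomes 1; hence the correction 2. *)
have normE x : `|(fiber x)%:R - 1| =
    (fiber x)%:R - 1 + 2 * (x \notin codom f)%:R :> algC.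
  case: (boolP (x \in codom f)) => [/codomP[y xfy]|xNf] /=.
    have : (0 < fiber x)%N by apply/card_gt0P; exists y; rewrite inE xfy.
    by move=> fx; rewrite mulr0 addr0 ger0_norm // subr_ge0 ler1n.
  rewrite (_ : fiber x = 0%N); first by rewrite sub0r normrN1 mulr1 addrC addrK.
  apply: eq_card0 => y; rewrite inE; apply: contraNF xNf => /eqP <-.
  exact: codom_f.
have sum_notin :
    \sum_x (x \notin codom f)%:R = #|Gamma|%:R - #|codom f|%:R :> algC.
  rewrite -(cardC (mem (codom f))) natrD addrC addKr -natr_sum -sum1_card.
  by rewrite [in RHS]big_mkcond.
rewrite energy_fiber_graph (eq_bigr _ (fun x _ => normE x)) big_split /=.
rewrite sumrB sum_fiber -mulr_sumr sum_notin sumr_const !natrM mulrBr.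
by rewrite subrr add0r.
Qed.

End FiberGraph.

(** A constant labelling makes the whole graph one fiber; the successor provides the label
    [ord0]. *)
Lemma energy_complete_graph (N : nat) :
  energy (complete_graph N.+1) = (2 * N.+1)%:R - 2.
Proof.
rewrite (@energy_fiber_graph_codom (complete_graph N.+1) (fun=> ord0)).
  rewrite card_ord (_ : #|codom _| = 1%N) ?muln1 //.
  rewrite -(card1 (ord0 : 'I_N.+1)); apply: eq_card => i; rewrite inE.
  by apply/codomP/eqP => [[]//|->]; exists ord0.
by move=> x y; rewrite eqxx andbT.
Qed.

Section ACGroup.

Variables (gT : finGroupType) (G : {group gT}).
Hypothesis acG : AC_group G.

Let commuting : rel (noncentral G) :=
  fun a b => (val a * val b == val b * val a)%g.

(** Both [a] and [c] lie in the centralizer of the noncentral element [b], which is abelian. *)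
Lemma commuting_trans : transitive commuting.
Proof.
move=> b a c /eqP ab /eqP bc.
have cent (x : noncentral G) :
    commute (val b) (val x) -> val x \in 'C_G[val b]%g.
  move=> bx; rewrite inE; apply/andP; split; last exact/cent1P.
  by have /setDP[]: val x \in G :\: 'Z(G)%g := valP x.
have /centsP cenC := acG (valP b).
by apply/eqP; exact: cenC (cent a (esym ab)) _ (cent c bc).
Qed.

Lemma commuting_sym : symmetric commuting.
Proof. by move=> a b; rewrite /commuting eq_sym. Qed.

(** A canonical element of the clique of [a]: [pick] depends only on the extension of its predicate.
    The default is never reached, since [a] commutes with itself. *)
Let rep (a : noncentral G) : noncentral G := odflt a [pick b | commuting a b].

Lemma eq_rep (a b : noncentral G) : (rep a == rep b) = commuting a b.
Proof.
have rep_comm x : commuting x (rep x).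
  by rewrite /rep; case: pickP => //= _; exact: eqxx.
apply/eqP/idP => [eq_ab|ab].
  apply: commuting_trans (rep_comm a) _.
  by rewrite eq_ab commuting_sym; exact: rep_comm.
have eqP : commuting a =1 commuting b.
  by apply: left_trans => //; [exact: commuting_sym | exact: commuting_trans].
rewrite /rep (eq_pick eqP); case: pickP => //= /(_ b) /negP[]; exact: eqxx.
Qed.

Lemma energy_commuting_graph :
  energy (commuting_graph G) =
    (2 * #|commuting_graph G|)%:R - (2 * #|codom rep|)%:R.
Proof.
by apply: energy_fiber_graph_codom => a b; rewrite eq_rep.
Qed.

(** Two elements of [G] that do not commute are both noncentral, and their representatives
    differ. *)
Lemma card_codom_rep_gt1 : ~~ abelian G -> (1 < #|codom rep|)%N.
Proof.
case/subsetPn=> x xG /centP xNC.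
have [y yG xy] : exists2 y, y \in G & ~~ (x * y == y * x)%g.
  apply/exists_inP; rewrite -negb_forall_in; apply/forall_inP => xC.
  by apply: xNC => y /xC /eqP.
have noncent u v : u \in G -> v \in G -> ~~ (u * v == v * u)%g ->
    u \in G :\: 'Z(G)%g.
  move=> uG vG uv; rewrite !inE uG andbT /=; apply: contra uv => /centP uC.
  by apply/eqP; exact: uC.
have yx : ~~ (y * x == x * y)%g by rewrite eq_sym.
pose a : noncentral G := Sub x (noncent x y xG yG xy).
pose b : noncentral G := Sub y (noncent y x yG xG yx).
apply/card_gt1P; exists (rep a), (rep b); split; rewrite ?codom_f //.
by rewrite eq_rep.
Qed.

End ACGroup.

Theorem theorem5 (gT : finGroupType) (G : {group gT})
    (nabG : ~~ abelian G) (acG : AC_group G) :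
  ~ hyperenergetic (commuting_graph G) /\ ~ borderenergetic (commuting_graph G).
Proof.
suff lt_energy : energy (commuting_graph G) <
    energy (complete_graph #|commuting_graph G|).
  split=> [/(lt_trans lt_energy)|eq_energy]; first by rewrite ltxx.
  by rewrite eq_energy ltxx in lt_energy.
have codom_gt1 := card_codom_rep_gt1 acG nabG.
rewrite (energy_commuting_graph acG).
have N_gt0 : (0 < #|commuting_graph G|)%N.
  exact: leq_trans (ltnW codom_gt1) (max_card _).
(* With N vertices and k cliques, 2N - 2k < 2N - 2 reduces to 2 < 2k. *)
rewrite -(prednK N_gt0) energy_complete_graph ltrD2l ltrN2 ltr_nat.
by rewrite (ltn_pmul2l (m := 2) (n1 := 1)).
Qed.
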